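(* Let $\pi$ be a permutation of $[n] = \{1,\dots,n\}$, $n \geq 1$. Then there is a simple permutation $\sigma$ of $[n+k]$ with $k \leq \lceil (n+1)/2 \rceil$ that contains $\pi$ as a pattern, i.e. there are indices $j_1 < j_2 < \dots < j_n$ in $[n+k]$ such that $\sigma(j_a) < \sigma(j_b)$ if and only if $\pi(a) < \pi(b)$ for all $a,b \in [n]$.
   Context: An interval of a permutation $\tau$ of $[m]$ is a set $I \subseteq [m]$ of positions that is a contiguous set of integers and whose set of values $\tau(I)$ is also a contiguous set of integers. The empty set, singletons and $[m]$ are intervals; other intervals are proper. A permutation is simple if it has no proper intervals. *)

(* Defs.v *)
From mathcomp Require Import all_boot all_fingroup.

Set Implicit Arguments.
Unset Strict Implicit.
Unset Printing Implicit Defensive.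

(* Permutations of [m] are elements of 'S_m, i.e. positions and values are
   numbered 0, ..., m - 1 instead of 1, ..., m. *)

(* A set of integers without gaps; in particular set0 is contiguous. *)
Definition contiguous (m : nat) (A : {set 'I_m}) : bool :=
  [forall x in A, forall y in A, forall z : 'I_m, (x <= z <= y) ==> (z \in A)].

Definition perm_interval (m : nat) (t : 'S_m) (I : {set 'I_m}) : bool :=
  contiguous I && contiguous (t @: I).

Definition proper_perm_interval (m : nat) (t : 'S_m) (I : {set 'I_m}) : bool :=
  [&& perm_interval t I, I != set0, #|I| != 1 & I != [set: 'I_m]].

Definition simple_perm (m : nat) (t : 'S_m) : bool :=
  ~~ [exists I : {set 'I_m}, proper_perm_interval t I].

Definition contains_pattern (m n : nat) (s : 'S_m) (p : 'S_n) : Prop :=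
  exists j : 'I_n -> 'I_m,
    (forall a b : 'I_n, a < b -> j a < j b) /\
    (forall a b : 'I_n, s (j a) < s (j b) <-> p a < p b).

(* Main.v *)
Require Import Defs.
From mathcomp Require Import all_boot all_fingroup.
From mathcomp Require Import all_order all_algebra zify.

(* Induction on n in steps of two, from the simple permutations 2413 and 25314,
   which contain all patterns of length 2 and 3: delete two points of the
   pattern, extend the rest to a simple permutation, then put the two points
   back and add a single new point x.  An interval of the enlarged permutation
   meets the simple one in everything or in at most one point, so x only has to
   separate each of the two points a and b from a possible twin (a point
   adjacent to it both in position and in value) and to keep them off the
   corners.
   - If the first point of the pattern is its maximum (other corners are
     symmetric), take it as a, and take for b a point with pattern points on both
     sides.  Put a in the top left corner, and x above everything, next to b on
     the side of the twin of b.
   - If neither end of the pattern is a maximum or a minimum, delete both ends a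
     and b.  Neither is extreme in value, so none is a corner.  Put them at the
     two ends, put x right after a, and at a height between b and its twin, or
     on top of everything if b has no twin. *)

Import Order.TTheory GRing.Theory Num.Theory.
Set Implicit Arguments.
Unset Strict Implicit.
Unset Printing Implicit Defensive.

Local Open Scope ring_scope.

(** * Planar point sets, intervals and simplicity *)

(* A permutation is encoded by a type of points with injective coordinates
   X (position) and Y (value), of which only the order matters. *)
Definition convex (T : Type) (F : T -> int) (A : pred T) :=
  forall u v w, A u -> A v -> F u <= F w <= F v -> A w.

Definition simple_points (T : Type) (X Y : T -> int) :=
  forall A : pred T, convex X A -> convex Y A ->
  forall u v, u <> v -> A u -> A v -> forall w, A w.

Definition between (T : Type) (F : T -> int) (u w v : T) : bool :=
  (F u < F w < F v) || (F v < F w < F u).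

Lemma convex_between (T : Type) (F : T -> int) (A : pred T) u v w :
  convex F A -> A u -> A v -> between F u w v -> A w.
Proof.
move=> cA Au Av /orP[] /andP[lt1 lt2].
  by apply: (cA u v) => //; rewrite !ltW.
by apply: (cA v u) => //; rewrite !ltW.
Qed.

Lemma convex_comp (T T' : Type) (i : T -> T') (F : T' -> int) (A : pred T') :
  convex F A -> convex (F \o i) (A \o i).
Proof. by move=> cA u v w; apply: cA. Qed.

Section Simple.
Variables (T : finType) (X Y : T -> int).
Hypotheses (injX : injective X) (injY : injective Y) (sXY : simple_points X Y).
Hypothesis (T3 : (2 < #|T|)%N).

Lemma simple_trichotomy (A : pred T) : convex X A -> convex Y A ->
  (forall t, A t) \/ (forall s t, A s -> A t -> s = t).
Proof.
move=> cX cY.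
case: (boolP [forall s, forall t, A s ==> A t ==> (s == t)]) => [/forallP H|].
  by right=> s t As At; move: (forallP (H s) t); rewrite As At => /eqP.
rewrite negb_forall => /existsP[s]; rewrite negb_forall => /existsP[t].
rewrite !negb_imply => /and3P[As At /eqP nst]; left.
exact: (sXY cX cY nst As At).
Qed.

Lemma third_point (s t : T) : exists w, w != s /\ w != t.
Proof.
have : (0 < #|~: [set s; t]|)%N.
  by have := cardsC [set s; t]; rewrite cards2; lia.
by case/card_gt0P=> w; rewrite !inE negb_or => /andP[ws wt]; exists w.
Qed.

(** Twins form a two-point interval, which misses any third point. *)
Lemma no_twins s t : s != t ->
  (forall w, ~~ between X s w t) -> (forall w, ~~ between Y s w t) -> False.
Proof.
move=> nst nX nY; have [w [ws wt]] := third_point s t.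
have cF (F : T -> int) : injective F -> (forall w, ~~ between F s w t) ->
    convex F (pred2 s t).
  move=> injF nF u v z /= + + uzv; have := nF z.
  have [->|nzs] := eqVneq z s; first by [].
  have [->|nzt] := eqVneq z t; first by [].
  have /eqP := contra_neq (@injF z s) nzs; have /eqP := contra_neq (@injF z t) nzt.
  by move=> ? ? + /orP[]/eqP Eu /orP[]/eqP Ev; subst; rewrite /between; lia.
have := sXY (cF X injX nX) (cF Y injY nY) (elimN eqP nst) _ _ w.
by rewrite /= !eqxx orbT (negPf ws) (negPf wt) => /(_ isT isT).
Qed.

(** The points other than a corner form an interval with at least two points that misses the
    corner. *)
Lemma no_corner (s : T) : (forall w, w != s -> X s < X w) ->
  (forall w, w != s -> Y w < Y s) -> False.
Proof.
move=> lX lY; have [u [us _]] := third_point s s.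
have [v [vs vu]] := third_point s u.
have cX : convex X (predC1 s).
  by move=> x y z /= /lX ? /lX ? ?; apply/eqP => zs; subst; lia.
have cY : convex Y (predC1 s).
  by move=> x y z /= /lY ? /lY ? ?; apply/eqP => zs; subst; lia.
by have := sXY cX cY (elimN eqP vu) vs us s; rewrite /= eqxx.
Qed.

End Simple.

(** * Adding three points to a simple point set *)

(* T' consists of the simple point set T, the two deleted points a and b and the
   new point x. *)
Section Steps.
Variables (T : finType) (T' : eqType) (i : T -> T') (a b x : T') (X Y : T' -> int).
Hypothesis cover : forall w, [\/ w = a, w = b, w = x | exists t, w = i t].
Hypothesis sXY : simple_points (X \o i) (Y \o i).
Hypothesis T3 : (2 < #|T|)%N.

(** An interval [A] with all old points captures [b] and [x] by position, then [a] by height, as [a]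
    lies between the old points and [x]. Otherwise [A] has at most one old point, and a second point
    next to [a], [x] or [b] is excluded in turn. *)
Lemma simple_add_corner (l r : T) :
  (forall t, X a < X (i t)) ->
  (forall t, Y (i t) < Y a) -> Y b < Y a -> Y a < Y x ->
  X (i l) < X b < X (i r) -> X (i l) < X x < X (i r) ->
  (forall u, (forall w, ~~ (between X b (i w) (i u))) ->
             (forall w, ~~ (between Y b (i w) (i u))) -> between X b x (i u)) ->
  simple_points X Y.
Proof.
move=> la ha hb hx lbr lxr cut A cX cY.
have [all|one] := simple_trichotomy sXY (convex_comp (i := i) cX) (convex_comp (i := i) cY).
  move=> u v _ _ _ w.
  have Ab : A b by apply: (cX _ _ _ (all l) (all r)); lia.
  have Ax : A x by apply: (cX _ _ _ (all l) (all r)); lia.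
  have Aa : A a by apply: (cY _ _ _ (all l) Ax); have := ha l; lia.
  by case: (cover w) => [E|E|E|[t E]]; subst w; rewrite ?all; try exact: all.
(* A second point besides [a] forces an old point [u] into [A]. Old points left of [u] or above it
   would join, so [u] is a top left corner of the old set. *)
have noa z : A a -> A z -> z <> a -> False.
  move=> Aa Az nza.
  have [u Au] : exists u, A (i u).
    case: (cover z) => [//|E|E|[t E]]; subst z; last by exists t.
      by exists l; apply: (cX _ _ _ Aa Az); have := la l; lia.
    by exists l; apply: (cX _ _ _ Aa Az); have := la l; lia.
  apply: (no_corner sXY T3 (s := u)) => w nwu /=; rewrite ltNge; apply/negP => le.
    have Aw : A (i w) by apply: (cX _ _ _ Aa Au); have := la w; lia.
    by move: nwu; rewrite (one _ _ Aw Au) eqxx.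
  have Aw : A (i w) by apply: (cY _ _ _ Au Aa); have := ha w; lia.
  by move: nwu; rewrite (one _ _ Aw Au) eqxx.
(* In height [a] comes right below [x], so [x] and any other point bring in [a]. *)
have nox z : A x -> A z -> z <> x -> False.
  move=> Ax Az nzx; have xa : x <> a by move=> E; move: hx; rewrite E; lia.
  apply: (noa x) => //; apply: (cY _ _ _ Az Ax).
  by case: (cover z) => [E|E|//|[t E]]; subst z; [lia|lia|have := ha t; lia].
(* An old point between [b] and [i s] would be a second one in [A]; so [i s] is a twin of [b], and
   [cut] puts [x] between them. *)
have nob s : A b -> A (i s) -> False.
  move=> Ab As.
  have nbs F w : convex F A -> ~~ between F b (i w) (i s).
    move=> cF; apply/negP => bt; have Aw := convex_between cF Ab As bt.
    by move: bt; rewrite (one _ _ Aw As) /between; lia.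
  have bt := cut s (fun w => nbs X w cX) (fun w => nbs Y w cY).
  apply: (nox (i s) (convex_between cX Ab As bt) As) => E.
  by move: bt; rewrite E /between; lia.
move=> u v nuv Au Av; exfalso.
case: (cover u) => [E|E|E|[s E]]; subst u.
- by apply: (noa v) => // E; apply: nuv.
- case: (cover v) => [E|E|E|[t E]]; subst v.
  + exact: (noa b).
  + exact: nuv.
  + exact: (nox b).
  + exact: (nob t).
- by apply: (nox v) => // E; apply: nuv.
- case: (cover v) => [E|E|E|[t E]]; subst v.
  + exact: (noa (i s)).
  + exact: (nob s).
  + exact: (nox (i s)).
  + by apply: nuv; rewrite (one _ _ Au Av).
Qed.

(** From left to right come [a], [x], the old points and [b], so only the rightmost old point [t]
    can be a twin of [b]. In the first alternative of [cut] some [e] separates the two in height, in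
    the second only [x] does. *)
Lemma simple_add_sides (la ha lb hb t : T) :
  injective Y ->
  X a < X x -> (forall w, X x < X (i w)) -> (forall w, X (i w) < X b) ->
  Y (i la) < Y a < Y (i ha) -> Y (i lb) < Y b < Y (i hb) ->
  (forall w, w != t -> X (i w) < X (i t)) ->
  (forall w, Y (i w) < Y x) /\ (exists2 e, e != x & between Y (i t) e b) \/
  between Y (i t) x b /\ (forall e, e != x -> ~~ between Y (i t) e b) ->
  simple_points X Y.
Proof.
move=> injY ax xi ib laa lbb rt cut A cX cY.
have [all|one] := simple_trichotomy sXY (convex_comp (i := i) cX) (convex_comp (i := i) cY).
  move=> u v _ _ _ w.
  have Ab : A b by apply: (cY _ _ _ (all lb) (all hb)); lia.
  have Aa : A a by apply: (cY _ _ _ (all la) (all ha)); lia.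
  have Ax : A x by apply: (cX _ _ _ Aa (all la)); have := xi la; lia.
  by case: (cover w) => [E|E|E|[s E]]; subst w; rewrite ?all; try exact: all.
(* All old points lie between [z] and [b] in position, but [A] holds at most one. *)
have noab z : A z -> X z <= X x -> A b -> False.
  move=> Az zx Ab; have [w [wt _]] := third_point T3 t t.
  have Ai s : A (i s) by apply: (cX _ _ _ Az Ab); have := xi s; have := ib s; lia.
  by move: wt; rewrite (one _ _ (Ai w) (Ai t)) eqxx.
(* An old [z] must be [t], which otherwise lies between [z] and [b] in position; then [e] or [x]
   joins [A] by height. *)
have nob z : A z -> A b -> z <> b -> False.
  move=> Az Ab nzb; case: (cover z) => [E|//|E|[u E]]; subst z.
  - by apply: (noab a) => //; lia.
  - by apply: (noab x) => //; lia.
  - have ut : u = t.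
      have At : A (i t).
        have [<-//|/rt ?] := eqVneq u t.
        by apply: (cX _ _ _ Az Ab); have := ib t; lia.
      exact: one.
    subst u; case: cut => [[_ [e nex bt]]|[bt _]]; have Ae := convex_between cY Az Ab bt.
      case: (cover e) => [E|E|E|[u E]]; subst e.
      + by apply: (noab a) => //; lia.
      + by move: bt; rewrite /between; lia.
      + by rewrite eqxx in nex.
      + by move: bt; rewrite (one _ _ Ae Az) /between; lia.
    by apply: (noab x) => //; lia.
have leftmost u w : A x -> A (i u) -> w != u -> X (i u) < X (i w).
  move=> Ax Au nwu; rewrite ltNge; apply/negP => le.
  have Aw : A (i w) by apply: (cX _ _ _ Ax Au); have := xi w; lia.
  by move: nwu; rewrite (one _ _ Aw Au) eqxx.
have nox z : A z -> A x -> z <> x -> False.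
  move=> Az Ax nzx.
  have nzb : z <> b by move=> E; subst z; apply: (nob x) => // E; apply: nzx.
  (* If [x] is above all old points, the old point of [A] is a top left corner. If [x] is between
     [t] and [b], then [z] lies on the side of [t], as [A] misses [b]; so [t] is in [A] and is both
     leftmost and rightmost. *)
  case: cut => [[top _]|[bt nbt]].
    have [u Au] : exists u, A (i u).
      case: (cover z) => [E|//|//|[u E]]; subst z; last by exists u.
      by exists ha; apply: (cY _ _ _ Az Ax); have := top ha; lia.
    apply: (no_corner sXY T3 (s := u)) => w nwu /=; first exact: leftmost.
    rewrite ltNge; apply/negP => le.
    have Aw : A (i w) by apply: (cY _ _ _ Au Ax); have := top w; lia.
    by move: nwu; rewrite (one _ _ Aw Au) eqxx.
  have nYxz : Y z <> Y x by move=> /injY.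
  have nYzb : Y z <> Y b by move=> /injY.
  have nb : ~ A b by move=> Ab; apply: (nob z).
  have At : A (i t).
    have [<-//|nzt] := eqVneq z (i t); apply: (convex_between cY Az Ax).
    have /eqP nYzt := contra_neq (@injY z (i t)) nzt.
    have := nbt z (introN eqP nzx).
    have : ~~ between Y z b x by apply/negP => /(convex_between cY Az Ax).
    by move: bt; rewrite /between; lia.
  have [w [wt _]] := third_point T3 t t.
  by have := leftmost t w Ax At wt; have := rt w wt; lia.
move=> u v nuv Au Av; exfalso.
have noa s : A a -> A (i s) -> False.
  move=> Aa As; have Ax : A x by apply: (cX _ _ _ Aa As); have := xi s; lia.
  by apply: (nox a) => // E; move: ax; rewrite E; lia.
case: (cover u) => [E|E|E|[s E]]; subst u; last first.
- case: (cover v) => [E|E|E|[r E]]; subst v.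
  + exact: (noa s).
  + exact: (nob (i s)).
  + exact: (nox (i s)).
  + by apply: nuv; rewrite (one _ _ Au Av).
- by apply: (nox v) => // E; apply: nuv.
- by apply: (nob v) => // E; apply: nuv.
- case: (cover v) => [E|E|E|[r E]]; subst v.
  + exact: nuv.
  + exact: (nob a).
  + exact: (nox a).
  + exact: (noa r).
Qed.

End Steps.

(** * Extrema, cuts and inserted coordinates *)

Lemma ex_minimum (W : finType) (D : {set W}) (F : W -> int) (w0 : W) :
  w0 \in D -> exists2 m, m \in D & forall w, w \in D -> F m <= F w.
Proof. by move=> Dw0; case: (arg_minP F Dw0) => m Dm le; exists m. Qed.

Lemma ex_maximum (W : finType) (D : {set W}) (F : W -> int) (w0 : W) :
  w0 \in D -> exists2 m, m \in D & forall w, w \in D -> F w <= F m.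
Proof. by move=> Dw0; case: (arg_maxP F Dw0) => m Dm le; exists m. Qed.

(** The maximum over [L] serves as cut, or one less than the minimum over [R] if [L] is empty. The
    weak and strict bounds match [insert], which places the new point just above [z]. *)
Lemma ex_cut (T : finType) (L R : pred T) (F : T -> int) :
  (forall s t, L s -> R t -> F s < F t) ->
  exists z, (forall s, L s -> F s <= z) /\ (forall t, R t -> z < F t).
Proof.
move=> LR; case: (pickP L) => [s0 Ls0|L0].
  have Ds0 : s0 \in [set s | L s] by rewrite inE.
  have [m] := ex_maximum F Ds0; rewrite inE => Lm le.
  by exists (F m); split=> [s Ls|t]; [apply: le; rewrite inE|apply: LR].
case: (pickP R) => [t0 Rt0|R0]; last by exists 0; split=> t; rewrite ?L0 ?R0.
have Dt0 : t0 \in [set t | R t] by rewrite inE.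
have [m] := ex_minimum F Dt0; rewrite inE => Rm le.
exists (F m - 1); split=> [s|t Rt]; first by rewrite L0.
by have := le t; rewrite inE => /(_ Rt); lia.
Qed.

Lemma ex_lower (T : finType) (F : T -> int) : exists z, forall t, z < F t.
Proof.
have [//|z [_ Rz]] := @ex_cut T pred0 predT F.
by exists z => t; apply: Rz.
Qed.

Lemma ex_upper (T : finType) (F : T -> int) : exists z, forall t, F t <= z.
Proof.
have [//|z [Lz _]] := @ex_cut T predT pred0 F.
by exists z => t; apply: Lz.
Qed.

(* Doubling the coordinates makes room for the new one at the odd number
   [2 * z + 1], just above the old coordinates that are at most [z]. *)
Definition insert (T : Type) (F : T -> int) (z : int) (o : option T) : int :=
  if o is Some t then 2 * F t else 2 * z + 1.

Lemma insert_inj (T : Type) (F : T -> int) z : injective F -> injective (insert F z).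
Proof. by move=> injF [s|] [t|] //= E; try congr Some; try apply: injF; lia. Qed.

(** One implication suffices: for injective [U] the converse follows by exchanging the two
    points. *)
Definition embeds (W : finType) (T : Type) (D : {set W}) (U : W -> int)
    (f : W -> T) (F : T -> int) :=
  {in D &, forall v w, U v < U w -> F (f v) < F (f w)}.

Definition extend_at (W : eqType) (T : Type) (c : W) (f : W -> T) (w : W) : option T :=
  if w == c then None else Some (f w).

Lemma embeds_insert_at (W : finType) (T : Type) (D : {set W}) U (f : W -> T) F c z :
  embeds D U f F ->
  {in D, forall w, U w < U c -> F (f w) <= z} ->
  {in D, forall w, U c < U w -> z < F (f w)} ->
  embeds (c |: D) U (extend_at c f) (insert F z).
Proof.
move=> emb lo hi v w; rewrite !inE /extend_at.
case: eqVneq => [->|_] /= Dv; case: eqVneq => [->|_] //= Dw lt.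
- by lia.
- by have := hi w Dw lt; lia.
- by have := lo v Dv lt; lia.
- by have := emb v w Dv Dw lt; lia.
Qed.

Lemma embeds_insert (W : finType) (T : Type) (D : {set W}) U (f : W -> T) F z :
  embeds D U f F -> embeds D U (Some \o f) (insert F z).
Proof. by move=> emb v w Dv Dw lt /=; have := emb v w Dv Dw lt; lia. Qed.

Lemma embeds_cut (W T : finType) (D : {set W}) U (f : W -> T) F c :
  embeds D U f F ->
  exists z, {in D, forall w, U w < U c -> F (f w) <= z} /\
            {in D, forall w, U c < U w -> z < F (f w)}.
Proof.
move=> emb.
have [|z [lo hi]] := @ex_cut W [pred w in D | U w < U c] [pred w in D | U c < U w] (F \o f).
  by move=> v w /= /andP[Dv lv] /andP[Dw lw]; apply: emb => //; lia.
exists z; split=> w Dw lw; first by apply: lo; rewrite inE Dw.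
by apply: hi; rewrite inE Dw.
Qed.

(** * Extending patterns: the two kinds of induction step *)

(** The exact size fits the induction: two points fewer in [D] mean three fewer in [T], namely [a],
    [b] and [x]. Patterns are subsets of a fixed [W], so deletion needs no renumbering. *)
Definition extendable (W : finType) (U V : W -> int) (D : {set W}) :=
  exists (T : finType) (f : W -> T) (X Y : T -> int),
    [/\ injective X, injective Y, simple_points X Y,
        #|T| = (#|D| + uphalf #|D|.+1)%N & embeds D U f X /\ embeds D V f Y].

Lemma ex_middle (W : finType) (D : {set W}) (U : W -> int) :
  injective U -> (2 < #|D|)%N ->
  exists l b r, [/\ l \in D, b \in D, r \in D & U l < U b < U r].
Proof.
move=> injU D3; have /card_gt0P[w0 Dw0] : (0 < #|D|)%N by lia.
have [l Dl le_l] := ex_minimum U Dw0; have [r Dr le_r] := ex_maximum U Dw0.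
have : (0 < #|D :\ l :\ r|)%N.
  by have := cardsD1 l D; have := cardsD1 r (D :\ l); lia.
case/card_gt0P=> b; rewrite !inE => /and3P[br bl Db]; exists l, b, r; split=> //.
have /eqP := contra_neq (@injU b r) br; have /eqP := contra_neq (@injU b l) bl.
by have := le_l b Db; have := le_r b Db; lia.
Qed.

Lemma between_insert (T : Type) (F : T -> int) z u w v :
  between (insert F z) (Some u) (Some w) (Some v) = between F u w v.
Proof. by rewrite /between /=; lia. Qed.

Lemma between_insert_new (T : Type) (F : T -> int) z u w v :
  ~~ between (insert F z) None (Some w) (Some u) ->
  ~~ between (insert F z) None (Some w) (Some v) -> ~~ between F u w v.
Proof. by rewrite /between /=; lia. Qed.

(* An inserted point has at most one twin, since two twins of it would be twins
   of each other. *)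
Lemma twin_side (T : finType) (X Y : T -> int) (xb yb : int) :
  injective X -> injective Y -> simple_points X Y -> (2 < #|T|)%N ->
  exists side : bool, forall u,
    (forall w, ~~ between (insert X xb) None (Some w) (Some u)) ->
    (forall w, ~~ between (insert Y yb) None (Some w) (Some u)) ->
    (X u <= xb) = side.
Proof.
move=> injX injY sXY T3.
pose twin u := [forall w, ~~ between (insert X xb) None (Some w) (Some u)] &&
               [forall w, ~~ between (insert Y yb) None (Some w) (Some u)].
case: (pickP twin) => [u /andP[/forallP Xu /forallP Yu]|no]; last first.
  by exists true => u Xu Yu; have := no u; rewrite /twin; do 2!case: forallP.
exists (X u <= xb) => v Xv Yv; have [->//|nvu] := eqVneq v u; exfalso.
apply: (no_twins injX injY sXY T3 nvu) => w.
  exact: between_insert_new (Xv w) (Xu w).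
exact: between_insert_new (Yv w) (Yu w).
Qed.

(** Serves to undo the doublings that [insert] applies to the old coordinates. *)
Lemma simple_points_mono (T : Type) (X Y X' Y' : T -> int) :
  (forall s t, (X' s <= X' t) = (X s <= X t)) ->
  (forall s t, (Y' s <= Y' t) = (Y s <= Y t)) ->
  simple_points X Y -> simple_points X' Y'.
Proof.
move=> mX mY sXY A cX cY; apply: (sXY A) => u v w Au Av; rewrite -?mX -?mY.
  exact: cX.
exact: cY.
Qed.

Lemma extendable_corner (W : finType) (U V : W -> int) (D : {set W}) (a : W) :
  injective U -> injective V -> (3 < #|D|)%N -> a \in D ->
  {in D, forall w, w != a -> U a < U w /\ V w < V a} ->
  (forall D' : {set W}, #|D'|.+2 = #|D| -> extendable U V D') ->
  extendable U V D.
Proof.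
move=> injU injV D4 Da corner IH.
have cDa := cardsD1 a D; rewrite Da in cDa.
have [|l [b [r [+ + + lbr]]]] := @ex_middle _ (D :\ a) U injU.
  by move: D4 cDa; clear; lia.
rewrite !inE => /andP[la Dl] /andP[ba Db] /andP[ra Dr].
pose D' := D :\ a :\ b.
have cD : #|D'|.+2 = #|D|.
  by have := cardsD1 b (D :\ a); rewrite !inE ba Db -/D' cDa; clear; lia.
have /andP[lb br] := lbr.
have D'l : l \in D' by rewrite !inE la Dl !andbT; apply: contraTneq lb => ->; rewrite ltxx.
have D'r : r \in D' by rewrite !inE ra Dr !andbT; apply: contraTneq br => ->; rewrite ltxx.
have DE : D = a |: (b |: D') by rewrite /D' !setD1K // !inE ba.
have [T [f [X [Y [injX injY sXY cT [eX eY]]]]]] := IH D' cD.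
have T3 : (2 < #|T|)%N by rewrite cT; move: cD D4; clear; lia.
have [xb [loX hiX]] := embeds_cut b eX.
have [yb [loY hiY]] := embeds_cut b eY.
have zl : X (f l) <= xb by apply: loX.
have zr : xb < X (f r) by apply: hiX.
have [side cut] := twin_side xb yb injX injY sXY T3.
have eX1 := embeds_insert_at eX loX hiX.
have eY1 := embeds_insert_at eY loY hiY.
set X1 := insert X xb in cut eX1; set Y1 := insert Y yb in cut eY1.
have [xa lxa] := ex_lower X1; have [ya uya] := ex_upper Y1.
have eX2 : embeds D U (extend_at a (extend_at b f)) (insert X1 xa).
  rewrite DE; apply: (embeds_insert_at eX1) => w D1w; last by move=> _; apply: lxa.
  have [->|nwa] := eqVneq w a; first by rewrite ltxx.
  have [|lt _] := corner w _ nwa; first by rewrite DE inE D1w orbT.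
  by move=> /(lt_trans lt); rewrite ltxx.
have eY2 : embeds D V (extend_at a (extend_at b f)) (insert Y1 ya).
  rewrite DE; apply: (embeds_insert_at eY1) => w D1w; first by move=> _; apply: uya.
  have [->|nwa] := eqVneq w a; first by rewrite ltxx.
  have [|_ lt] := corner w _ nwa; first by rewrite DE inE D1w orbT.
  by move=> /(lt_trans lt); rewrite ltxx.
have [yx uyx] := ex_upper (insert Y1 ya).
(* In the coordinate [insert X1 xa] the point [b] sits at [2 * X1 None]. This cut puts [x]
   immediately left of [b] if its twin would be on the left, and immediately right otherwise. *)
pose xx := 2 * X1 None - (if side then 1 else 0).
exists (option (option (option T))), (Some \o extend_at a (extend_at b f)).
exists (insert (insert X1 xa) xx), (insert (insert Y1 ya) yx).
split; [by do 3!apply: insert_inj|by do 3!apply: insert_inj| | |].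
- apply: (@simple_add_corner T _ (fun t => Some (Some (Some t)))
    (Some None) (Some (Some None)) None _ _ _ _ T3 (f l) (f r)).
  + by case=> [[[t|]|]|]; [apply: Or44; exists t|apply: Or42|apply: Or41|apply: Or43].
  + by apply: simple_points_mono sXY => s t /=; clear; lia.
  + by move=> t; move: (lxa (Some t)) => /=; clear; lia.
  + by move=> t; move: (uya (Some t)) => /=; clear; lia.
  + by move: (uya None) => /=; clear; lia.
  + by move: (uyx None) => /=; clear; lia.
  + by move: zl zr => /=; clear; lia.
  + by move: zl zr; rewrite /xx; case: (side) => /=; clear; lia.
  + move=> u Xu Yu; have := cut u; rewrite /xx => <-.
    * by rewrite /between /X1 /=; case: (leP (X u) xb); clear; lia.
    * by move=> w; move: (Xu w); rewrite !between_insert.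
    * by move=> w; move: (Yu w); rewrite !between_insert.
- by rewrite !card_option cT; move: cD; clear; lia.
- by split; apply: embeds_insert.
Qed.

(** Being strictly below or above both ends, [lo] and [hi] survive the deletion, and their images
    bound [a] and [b] in height. *)
Lemma extendable_sides (W : finType) (U V : W -> int) (D : {set W}) (a b lo hi : W) :
  injective U -> injective V -> (3 < #|D|)%N ->
  a \in D -> b \in D -> lo \in D -> hi \in D ->
  {in D, forall w, w != a -> U a < U w} ->
  {in D, forall w, w != b -> U w < U b} ->
  V lo < V a < V hi -> V lo < V b < V hi ->
  (forall D' : {set W}, #|D'|.+2 = #|D| -> extendable U V D') ->
  extendable U V D.
Proof.
move=> injU injV D4 Da Db Dlo Dhi lefta rightb /andP[loa ahi] /andP[lob bhi] IH.
have nab : a != b.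
  apply/eqP => E; have /negP[] : ~~ (#|D| <= 1)%N by rewrite -ltnNge; move: D4; clear; lia.
  rewrite -(cards1 a); apply/subset_leq_card/subsetP => w Dw; rewrite inE.
  apply/eqP/eqP/idPn => nwa; have := rightb w Dw; rewrite -E => /(_ nwa).
  by move=> /(lt_trans (lefta w Dw nwa)); rewrite ltxx.
pose D' := D :\ a :\ b.
have DE : D = b |: (a |: D').
  by rewrite setUCA /D' setD1K ?setD1K // !inE eq_sym nab.
have cD : #|D'|.+2 = #|D|.
  have := cardsD1 a D; have := cardsD1 b (D :\ a).
  by rewrite !inE eq_sym nab Db Da -/D'; clear; lia.
have D'E w : w \in D -> V w != V a -> V w != V b -> w \in D'.
  by move=> Dw nwa nwb; rewrite !inE Dw andbT; apply/andP; split;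
     [apply: contraNneq nwb|apply: contraNneq nwa] => ->.
have D'lo : lo \in D' by apply: D'E => //; rewrite lt_eqF.
have D'hi : hi \in D' by apply: D'E => //; rewrite gt_eqF.
have [T [f [X [Y [injX injY sXY cT [eX eY]]]]]] := IH D' cD.
have T3 : (2 < #|T|)%N by rewrite cT; move: cD D4; clear; lia.
have [ya [loa' hia']] := embeds_cut a eY.
have eY1 := embeds_insert_at eY loa' hia'.
have [yb [lob' hib']] := embeds_cut b eY1.
have eY2 := embeds_insert_at eY1 lob' hib'; rewrite -DE in eY2.
have [xa lxa] := ex_lower X.
have [xb uxb] := ex_upper (insert X xa).
have eX1 : embeds (a |: D') U (extend_at a f) (insert X xa).
  apply: (embeds_insert_at eX) => w D'w; last by move=> _; apply: lxa.
  have Dw : w \in D by rewrite DE 2!in_setU1 D'w !orbT.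
  have nwa : w != a by move: D'w; rewrite !inE => /and3P[].
  by move=> /(lt_trans (lefta w Dw nwa)); rewrite ltxx.
have eX2 : embeds D U (extend_at b (extend_at a f)) (insert (insert X xa) xb).
  rewrite DE; apply: (embeds_insert_at eX1) => w D'w; first by move=> _; apply: uxb.
  have Dw : w \in D by rewrite DE in_setU1 D'w orbT.
  have [->|nwb] := eqVneq w b; first by rewrite ltxx.
  by move=> /(lt_trans (rightb w Dw nwb)); rewrite ltxx.
have [t _ maxt] := ex_maximum X (in_setT (f a)).
have {}maxt w : w != t -> X w < X t.
  by move=> nwt; rewrite lt_neqAle maxt ?inE // andbT (inj_eq injX).
set X2 := insert (insert X xa) xb in eX2; set Y2 := insert (insert Y ya) yb in eY2.
(* If an old point or [a] separates [t] from [b] in height, [x] goes on top. Otherwise the cut at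
   the lower of the two heights puts [x] between them. *)
have [yx cut] : exists yx,
    (forall o, Y2 o <= yx) /\ (exists e, between Y2 (Some (Some t)) e None) \/
    between (insert Y2 yx) (Some (Some (Some t))) None (Some None) /\
    (forall e, ~~ between Y2 (Some (Some t)) e None).
  case: (boolP [exists e, between Y2 (Some (Some t)) e None]) => [/existsP bt|].
    by have [yx uyx] := ex_upper Y2; exists yx; left.
  rewrite negb_exists => /forallP nbt; exists (Num.min (Y2 (Some (Some t))) (Y2 None)).
  by right; split=> //; rewrite /between /=; clear; lia.
exists (option (option (option T))), (Some \o extend_at b (extend_at a f)).
(* [X2 (Some None)] is the position of [a], so [x] comes immediately after [a]. *)
exists (insert X2 (X2 (Some None))), (insert Y2 yx).
split; [by do 3!apply: insert_inj|by do 3!apply: insert_inj| | |].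
- have V2 v w : v \in D -> w \in D -> V v < V w ->
    Y2 (extend_at b (extend_at a f) v) < Y2 (extend_at b (extend_at a f) w) by apply: eY2.
  have outside c : c \in D' -> extend_at b (extend_at a f) c = Some (Some (f c)).
    by rewrite !inE /extend_at => /and3P[/negPf-> /negPf->].
  have ata : extend_at b (extend_at a f) a = Some None.
    by rewrite /extend_at (negPf nab) eqxx.
  have atb : extend_at b (extend_at a f) b = None by rewrite /extend_at eqxx.
  have := V2 lo a Dlo Da loa; have := V2 a hi Da Dhi ahi.
  have := V2 lo b Dlo Db lob; have := V2 b hi Db Dhi bhi.
  rewrite ata atb !outside // => bhi' lob'' ahi' loa''.
  apply: (@simple_add_sides T _ (fun t => Some (Some (Some t)))
    (Some (Some None)) (Some None) None _ _ _ _ T3 (f lo) (f hi) (f lo) (f hi) t).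
  + by case=> [[[u|]|]|]; [apply: Or44; exists u|apply: Or41|apply: Or42|apply: Or43].
  + by apply: simple_points_mono sXY => u v /=; clear; lia.
  + by do 3!apply: insert_inj.
  + by rewrite /=; clear; lia.
  + by move=> w; move: (lxa w) => /=; clear; lia.
  + by move=> w; move: (uxb (Some w)) => /=; clear; lia.
  + by move: ahi' loa'' => /=; clear; lia.
  + by move: bhi' lob'' => /=; clear; lia.
  + by move=> w /maxt /=; clear; lia.
  + case: cut => [[top [e bt]]|[bt nbt]]; [left; split|right; split=> //].
    * by move=> w; move: (top (Some (Some w))) => /=; clear; lia.
    * by exists (Some e); rewrite // between_insert.
    * by case=> // e _; rewrite between_insert.
- by rewrite !card_option cT; move: cD; clear; lia.
- by split; apply: embeds_insert.
Qed.

(** * Symmetries and the case distinction of the induction step *)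

Lemma convex_opp (T : Type) (F : T -> int) A : convex (fun t => - F t) A -> convex F A.
Proof. by move=> cA u v w Au Av uwv; apply: (cA v u) => //; rewrite !lerN2 andbC. Qed.

Lemma simple_points_swap (T : Type) (X Y : T -> int) :
  simple_points X Y -> simple_points Y X.
Proof. by move=> sXY A cY cX; apply: sXY. Qed.

Lemma simple_points_opp (T : Type) (X Y : T -> int) :
  simple_points X Y -> simple_points (fun t => - X t) Y.
Proof. by move=> sXY A cX cY; apply: sXY => //; apply: convex_opp. Qed.

Lemma embeds_opp (W : finType) (T : Type) (D : {set W}) U (f : W -> T) F :
  embeds D (fun w => - U w) f F -> embeds D U f (fun t => - F t).
Proof. by move=> emb v w Dv Dw lt; rewrite ltrN2 emb ?ltrN2. Qed.

Lemma extendable_swap (W : finType) (U V : W -> int) (D : {set W}) :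
  extendable U V D -> extendable V U D.
Proof.
case=> T [f [X [Y [injX injY sXY cT [eX eY]]]]]; exists T, f, Y, X; split=> //.
exact: simple_points_swap.
Qed.

Lemma extendable_opp (W : finType) (U V : W -> int) (D : {set W}) :
  extendable (fun w => - U w) V D -> extendable U V D.
Proof.
case=> T [f [X [Y [injX injY sXY cT [eX eY]]]]].
exists T, f, (fun t => - X t), Y; split=> //; first by move=> s t /oppr_inj /injX.
  exact: simple_points_opp.
by split=> //; apply: embeds_opp.
Qed.

(** A corner is an end [a] or [b] that is also the lowest point [l] or the highest point [h];
    reflections move it to the top left. Hence the induction hypothesis ranges over all
    coordinates. *)
Lemma extendable_step (W : finType) (D : {set W}) :
  (3 < #|D|)%N ->
  (forall (U V : W -> int) (D' : {set W}), injective U -> injective V ->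
     #|D'|.+2 = #|D| -> extendable U V D') ->
  forall U V : W -> int, injective U -> injective V -> extendable U V D.
Proof.
move=> D4 IH U V injU injV.
have /card_gt0P[w0 Dw0] : (0 < #|D|)%N by move: D4; clear; lia.
have strict_min (F : W -> int) (injF : injective F) : exists2 m, m \in D &
    {in D, forall w, w != m -> F m < F w}.
  have [m Dm le] := ex_minimum F Dw0; exists m => // w Dw nwm.
  by rewrite lt_neqAle le // andbT (inj_eq injF) eq_sym.
have injN (F : W -> int) : injective F -> injective (fun w : W => - F w).
  by move=> injF v w /oppr_inj /injF.
have [a Da mina] := strict_min U injU; have [b Db minb] := strict_min _ (injN U injU).
have [l Dl minl] := strict_min V injV; have [h Dh minh] := strict_min _ (injN V injV).
have [ah|nah] := eqVneq a h.
  subst h; apply: (extendable_corner injU injV D4 Da) => [w Dw nw|D' cD]; last exact: IH.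
  by split; [exact: mina|rewrite -ltrN2; exact: minh].
have [al|nal] := eqVneq a l.
  (* Conjugating by the swap reflects the second coordinate. *)
  subst l; apply/extendable_swap/extendable_opp/extendable_swap.
  apply: (extendable_corner injU (injN V injV) D4 Da) => [w Dw nw|D' cD].
    by split; [exact: mina|rewrite ltrN2; exact: minl].
  by apply: IH => //; apply: injN.
have [bh|nbh] := eqVneq b h.
  subst h; apply: extendable_opp.
  apply: (extendable_corner (injN U injU) injV D4 Db) => [w Dw nw|D' cD].
    by split; [exact: minb|rewrite -ltrN2; exact: minh].
  by apply: IH => //; apply: injN.
have [bl|nbl] := eqVneq b l.
  subst l; apply/extendable_opp/extendable_swap/extendable_opp/extendable_swap.
  apply: (extendable_corner (injN U injU) (injN V injV) D4 Db) => [w Dw nw|D' cD].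
    by split; [exact: minb|rewrite ltrN2; exact: minl].
  by apply: IH => //; apply: injN.
apply: (@extendable_sides W U V D a b l h) => //.
- by move=> w Dw nw; rewrite -ltrN2 minb.
- by rewrite minl // -ltrN2 minh.
- by rewrite minl // -ltrN2 minh.
- by move=> D' cD; apply: IH.
Qed.

(** * Base cases: patterns of length 2 and 3 *)

(** A Boolean form of being an interval: for a concrete [s] it computes to a formula in [B 0], [B 1]
    and so on, open to case analysis. *)
Definition closed_positions (s : seq nat) (B : nat -> bool) : bool :=
  all (fun i => all (fun j => all (fun k =>
    (i <= j <= k)%N || (nth 0 s i <= nth 0 s j <= nth 0 s k)%N ==>
      B i ==> B k ==> B j) (iota 0 (size s))) (iota 0 (size s))) (iota 0 (size s)).

Definition trivial_positions (s : seq nat) (B : nat -> bool) : bool :=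
  all (fun i => all (fun j => (i != j) ==> B i ==> B j ==> all B (iota 0 (size s)))
    (iota 0 (size s))) (iota 0 (size s)).

Lemma simple_points_nth (s : seq nat) (n : nat) : size s = n ->
  (forall B, closed_positions s B -> trivial_positions s B) ->
  simple_points (fun i : 'I_n => (i : nat)%:Z) (fun i : 'I_n => (nth 0 s i)%:Z).
Proof.
move=> <- full A cX cY u v nuv Au Av w.
(* [A] is extended by [false] beyond the positions of [s]. *)
pose B k := if insub k is Some i then A i else false.
have BE (i : 'I_(size s)) : B i = A i by rewrite /B valK.
have mem (i : 'I_(size s)) : (i : nat) \in iota 0 (size s) by rewrite mem_iota ltn_ord.
have /full : closed_positions s B.
  apply/allP => i; rewrite mem_iota => /= lti; apply/allP => j; rewrite mem_iota => /= ltj.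
  apply/allP => k; rewrite mem_iota => /= ltk.
  rewrite -[i]/(nat_of_ord (Ordinal lti)) -[j]/(nat_of_ord (Ordinal ltj)).
  rewrite -[k]/(nat_of_ord (Ordinal ltk)) !BE.
  apply/implyP => /orP h; apply/implyP => Ai; apply/implyP => Ak.
  by case: h => h; [apply: (cX _ _ _ Ai Ak)|apply: (cY _ _ _ Ai Ak)].
move=> /allP/(_ _ (mem u))/allP/(_ _ (mem v)); rewrite !BE Au Av implyTb.
have -> : (u : nat) != v by apply/eqP => /val_inj.
by move=> /allP/(_ _ (mem w)); rewrite BE.
Qed.

Lemma simple_points_2413 :
  simple_points (fun i : 'I_4 => (i : nat)%:Z) (fun i : 'I_4 => (nth 0%N [:: 1; 3; 0; 2]%N i)%:Z).
Proof.
apply: simple_points_nth => // B; rewrite /closed_positions /trivial_positions /=.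
by case: (B 0%N); case: (B 1%N); case: (B 2%N); case: (B 3%N).
Qed.

Lemma simple_points_25314 :
  simple_points (fun i : 'I_5 => (i : nat)%:Z)
    (fun i : 'I_5 => (nth 0%N [:: 1; 4; 2; 0; 3]%N i)%:Z).
Proof.
apply: simple_points_nth => // B; rewrite /closed_positions /trivial_positions /=.
by case: (B 0%N); case: (B 1%N); case: (B 2%N); case: (B 3%N); case: (B 4%N).
Qed.

Lemma nth_inj (s : seq nat) (n : nat) :
  size s = n -> uniq s -> injective (fun i : 'I_n => (nth 0 s i)%:Z).
Proof.
move=> <- us i j [] /eqP; rewrite nth_uniq // => /eqP; exact: val_inj.
Qed.

Lemma extendable2 (W : finType) (U V : W -> int) (D : {set W}) :
  injective U -> injective V -> #|D| = 2%N -> extendable U V D.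
Proof.
move=> injU injV /eqP cD.
have [x [y [DE lt]]] : exists x y, D = [set x; y] /\ U x < U y.
  have /cards2P[x [y [nxy ->]]] := cD; have [lt|lt|/injU E] := ltgtP (U x) (U y).
  - by exists x, y.
  - by exists y, x; rewrite setUC.
  - by rewrite E eqxx in nxy.
have nyx : y == x = false by apply/eqP => E; rewrite E ltxx in lt.
pose f i j w : 'I_4 := if w == x then inord i else inord j.
(* In 2413 the positions 0 and 1 carry an ascent, 1 and 2 a descent. *)
exists 'I_4, (if V x < V y then f 0%N 1%N else f 1%N 2%N), (fun i : 'I_4 => (i : nat)%:Z),
  (fun i : 'I_4 => (nth 0%N [:: 1; 3; 0; 2]%N i)%:Z).
split; [by move=> i j [] /val_inj|exact: nth_inj|exact: simple_points_2413| |].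
  by rewrite card_ord (eqP cD).
split=> v w; rewrite DE !inE => /orP[]/eqP-> /orP[]/eqP->;
  case: (ltgtP (V x) (V y)) => V_ ; rewrite /f ?eqxx ?nyx ?inordK //=; move: lt V_; clear; lia.
Qed.

Lemma extendable3 (W : finType) (U V : W -> int) (D : {set W}) :
  injective U -> injective V -> #|D| = 3%N -> extendable U V D.
Proof.
move=> injU injV cD.
have [|x [y [z [Dx Dy Dz /andP[xy yz]]]]] := @ex_middle _ D U injU; first by rewrite cD.
have nyx : y == x = false by apply/eqP => E; rewrite E ltxx in xy.
have nzy : z == y = false by apply/eqP => E; rewrite E ltxx in yz.
have nzx : z == x = false by apply/eqP => E; have := lt_trans xy yz; rewrite E ltxx.
have DE : D = [set x; y; z].
  apply/eqP; rewrite eq_sym eqEcard; apply/andP; split.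
    by apply/subsetP => w; rewrite !inE => /orP[/orP[]|] /eqP->.
  by rewrite cD setUC cardsU1 cards2 !inE nzx nzy eq_sym nyx.
suff [i [j [k [ij jk k5 emb]]]] : exists i j k : nat, [/\ (i < j)%N, (j < k)%N, (k < 5)%N &
   forall Y, Y = nth 0%N [:: 1; 4; 2; 0; 3]%N ->
   [/\ V x < V y -> (Y i < Y j)%N, V y < V x -> (Y j < Y i)%N,
       V x < V z -> (Y i < Y k)%N, V z < V x -> (Y k < Y i)%N &
       (V y < V z -> (Y j < Y k)%N) /\ (V z < V y -> (Y k < Y j)%N)]].
  exists 'I_5, (fun w => inord (if w == x then i else if w == y then j else k)),
    (fun i : 'I_5 => (i : nat)%:Z), (fun i : 'I_5 => (nth 0%N [:: 1; 4; 2; 0; 3]%N i)%:Z).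
  split; [by move=> ? ? [] /val_inj|exact: nth_inj|exact: simple_points_25314| |].
    by rewrite card_ord cD.
  have j5 := ltn_trans jk k5; have i5 := ltn_trans ij j5.
  have [Vxy Vyx Vxz Vzx [Vyz Vzy]] := emb _ erefl.
  split=> v w; rewrite DE !inE => /orP[/orP[]|]/eqP-> /orP[/orP[]|]/eqP->;
  rewrite ?eqxx ?nyx ?nzy ?nzx ?inordK ?ltxx ?ltz_nat //; 
  by move=> lt; rewrite ?(ltn_trans ij jk) //; move: xy yz lt; clear; lia.
have neq u v : v == u = false -> V u != V v by rewrite eq_sym (inj_eq injV) => ->.
move: (neq _ _ nyx) (neq _ _ nzy) (neq _ _ nzx).
case: (ltgtP (V x) (V y)) => // xy' _; case: (ltgtP (V y) (V z)) => // yz' _;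
case: (ltgtP (V x) (V z)) => // xz' _.
(* The positions in 25314 carry 123, 132, 231, 213, 312 and 321, in this order; the two other cases
   are cyclic comparisons. *)
- by exists 0%N, 2%N, 4%N; split=> // _ ->.
- by have := lt_trans xy' yz'; rewrite ltNge ltW.
- by exists 0%N, 1%N, 4%N; split=> // _ ->.
- by exists 0%N, 1%N, 3%N; split=> // _ ->.
- by exists 0%N, 3%N, 4%N; split=> // _ ->.
- by exists 1%N, 2%N, 4%N; split=> // _ ->.
- by have := lt_trans yz' xy'; rewrite ltNge ltW.
- by exists 1%N, 2%N, 3%N; split=> // _ ->.
Qed.

Lemma extendable_all (W : finType) (U V : W -> int) (D : {set W}) :
  injective U -> injective V -> (1 < #|D|)%N -> extendable U V D.
Proof.
move=> injU injV; have [m] := ubnP #|D|.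
elim: m U V D injU injV => // m IH U V D injU injV Dm D1.
have [D4|] := ltnP 3 #|D|.
  apply: extendable_step => // U' V' D' injU' injV' cD.
  by apply: IH => //; move: Dm D4; rewrite -cD; clear; lia.
rewrite leq_eqVlt => /orP[/eqP|D3]; first exact: extendable3.
by apply: extendable2 => //; move: D1 D3; clear; lia.
Qed.

(** * From point sets back to permutations *)

(** The rank counts the points strictly before the given one. *)
Lemma rank_points (T : finType) (X : T -> int) (N : nat) : injective X -> #|T| = N ->
  exists r : T -> 'I_N, bijective r /\ forall s t, (r s < r t)%N = (X s < X t).
Proof.
move=> injX cT; pose below t := [set u | X u < X t].
have lt_below s t : X s < X t -> (#|below s| < #|below t|)%N.
  move=> lt; apply/proper_card/properP; split.
    by apply/subsetP => u; rewrite !inE => /lt_trans; apply.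
  by exists s; rewrite !inE ?ltxx.
have bound t : (#|below t| < N)%N.
  rewrite -cT -cardsT; apply/proper_card/properP; split; first exact/subsetP.
  by exists t; rewrite !inE ?ltxx.
pose r t := Ordinal (bound t).
have mono s t : (r s < r t)%N = (X s < X t).
  have [/lt_below//|/lt_below gt|/injX->] := ltgtP (X s) (X t); last by rewrite ltnn.
  by rewrite /= ltnNge ltnW.
exists r; split=> //; apply: inj_card_bij; last by rewrite card_ord cT.
move=> s t E; have := mono s t; have := mono t s; rewrite E ltnn.
by case: (ltgtP (X s) (X t)) => // /injX.
Qed.

(** The permutation sends the [X]-rank of each point to its [Y]-rank; an interval of it pulls back
    along [r] to a set convex in both coordinates. *)
Lemma perm_of_points (T : finType) (X Y : T -> int) (N : nat) :
  injective X -> injective Y -> simple_points X Y -> #|T| = N ->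
  exists (s : 'S_N) (r : T -> 'I_N),
    [/\ simple_perm s, forall u v, (r u < r v)%N = (X u < X v)
      & forall u v, (s (r u) < s (r v))%N = (Y u < Y v)].
Proof.
move=> injX injY sXY cT.
have [r [[r' rK r'K] rlt]] := rank_points injX cT.
have [q [[q' qK q'K] qlt]] := rank_points injY cT.
have injs : injective (q \o r') by apply: inj_comp; apply: can_inj; eassumption.
exists (perm injs), r; split=> // [|u v]; last by rewrite !permE /= !rK.
have sr u : perm injs (r u) = q u by rewrite permE /= rK.
apply/negP => /existsP[I /and4P[/andP[cX cY] I0 I1 IT]].
have /set0Pn[i Ii] := I0.
have [j Ij nji] : exists2 j, j \in I & j != i.
  apply/exists_inP; apply: contraNT I1 => /exists_inPn one.
  apply/cards1P; exists i; apply/setP => j; rewrite inE.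
  by apply/idP/eqP => [/one/negPn/eqP|->].
pose A t := r t \in I.
have leE (F : T -> int) (k : T -> 'I_N) : (forall u v, (k u < k v)%N = (F u < F v)) ->
    forall u v, (k u <= k v)%N = (F u <= F v).
  by move=> klt u v; rewrite leqNgt klt leNgt.
have convX : convex X A.
  move=> u v w Au Av; rewrite -!(leE _ _ rlt) => uwv.
  by move/'forall_in_'forall_in_forallP: cX => /(_ _ Au _ Av (r w)); rewrite uwv.
have convY : convex Y A.
  move=> u v w Au Av; rewrite -!(leE _ _ qlt) => uwv.
  have im t : A t -> q t \in perm injs @: I by move=> At; rewrite -sr imset_f.
  move/'forall_in_'forall_in_forallP: cY => /(_ _ (im u Au) _ (im v Av) (q w)).
  rewrite uwv => /imsetP[k Ik]; rewrite -sr => /perm_inj E.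
  by rewrite /A E.
case/negP: IT; apply/eqP/setP => k; rewrite inE -(r'K k).
apply: (sXY A convX convY (r' i) (r' j)); rewrite /A ?r'K //.
by move/(can_inj r'K)/eqP; rewrite eq_sym (negPf nji).
Qed.

Local Close Scope ring_scope.

(* uphalf n.+1 is the ceiling of (n + 1) / 2 *)
Theorem theorem4p1 (n : nat) (hn : 1 <= n) (p : 'S_n) :
  exists k : nat, k <= uphalf n.+1 /\
    exists s : 'S_(n + k), simple_perm s /\ contains_pattern s p.
Proof.
have [n1|n1] := leqP n 1.
  (* The induction starts at two points; a single point is itself simple, with [k = 0]. *)
  have {n1 hn} E : n = 1 by apply/eqP; rewrite eqn_leq n1.
  subst n; exists 0; split=> //; exists 1%g; split.
    apply/negP => /existsP[I /and4P[_ I0 I1 _]].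
    have := max_card (mem I); rewrite card_ord leq_eqVlt (negPf I1) /= ltnS leqn0 cards_eq0.
    by rewrite (negPf I0).
  by exists (fun i => i); split=> a b; rewrite (ord1 a) (ord1 b) ?ltnn.
have injU : injective (fun i : 'I_n => Posz i) by move=> i j [] /val_inj.
have injV : injective (fun i : 'I_n => Posz (p i)) by move=> i j [] /val_inj /perm_inj.
have [|T [f [X [Y [injX injY sXY]]]]] := @extendable_all _ _ _ [set: 'I_n] injU injV.
  by rewrite cardsT card_ord.
rewrite cardsT card_ord => cT [eX eY].
have [s [r [simple_s rX rY]]] := perm_of_points injX injY sXY cT.
exists (uphalf n.+1); split=> //; exists s; split=> //.
exists (r \o f); split=> a b /=; first by move=> ab; rewrite rX; apply: eX.
rewrite rY; split=> [lt|lt]; last by apply: eY.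
(* Equal values force [a = b], and [eY] would transport the opposite order. *)
rewrite ltnNge; apply/negP; rewrite leq_eqVlt => /orP[/eqP/val_inj/perm_inj E|gt].
  by move: lt; rewrite E ltxx.
have /lt_trans/(_ lt) : (Y (f b) < Y (f a))%R by apply: eY.
by rewrite ltxx.
Qed.
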